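(* Let $a$ be a vertex in a graph $X$ and let $Z$ be the graph formed from $X$ by joining two new vertices of valency one to $a$. If $\operatorname{mult}(0,X\setminus a)\le\operatorname{mult}(0,X)$, then the two new vertices are strongly cospectral in $Z$.
   Context: Graphs are finite, simple and undirected. For a graph $Y$ with adjacency matrix $A(Y)$, $\phi(Y,t)=\det(tI-A(Y))$ (equal to $1$ if $Y$ has no vertices), and $\operatorname{mult}(\theta,Y)$ denotes the multiplicity of $\theta$ as a zero of $\phi(Y,t)$ (zero if $\theta$ is not a zero). $X\setminus a$ is the graph obtained by deleting $a$. In $Z$, each of the two new vertices has $a$ as its only neighbour. Let $E_r$ denote the orthogonal projections onto the distinct eigenspaces of $A(Z)$ and let $e_w$ be the standard basis vectors of $\mathbb{R}^{V(Z)}$. Vertices $b,c$ are strongly cospectral in $Z$ if for each $r$ we have $E_re_b=E_re_c$ or $E_re_b=-E_re_c$. *)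

(* Defs.v *)
From HB Require Import structures.
From mathcomp Require Import all_boot all_order all_algebra.
From mathcomp Require Import reals.

Set Implicit Arguments.
Unset Strict Implicit.
Unset Printing Implicit Defensive.

Import Order.TTheory GRing.Theory Num.Theory.
Local Open Scope ring_scope.

Record sgraph := SGraph {
  vertex :> finType;
  edge : rel vertex;
  edge_sym : symmetric edge;
  edge_irrefl : irreflexive edge }.

Section DeleteVertex.
Variables (X : sgraph) (a : X).

Definition del_edge (u v : {x : X | x != a}) := edge (val u) (val v).

Fact del_edge_sym : symmetric del_edge.
Proof. by move=> u v; exact: edge_sym. Qed.

Fact del_edge_irrefl : irreflexive del_edge.
Proof. by move=> u; exact: edge_irrefl. Qed.

Definition del_vertex := SGraph del_edge_sym del_edge_irrefl.
End DeleteVertex.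

(* The two new vertices are [inr false] and [inr true]. *)
Section TwoPendants.
Variables (X : sgraph) (a : X).

Definition pendant_edge (u v : X + bool) : bool :=
  match u, v with
  | inl x, inl y => edge x y
  | inl x, inr _ => x == a
  | inr _, inl y => y == a
  | inr _, inr _ => false
  end.

Fact pendant_edge_sym : symmetric pendant_edge.
Proof. by move=> [x|i] [y|j] //=; exact: edge_sym. Qed.

Fact pendant_edge_irrefl : irreflexive pendant_edge.
Proof. by move=> [x|i] //=; exact: edge_irrefl. Qed.

Definition add_two_pendants := SGraph pendant_edge_sym pendant_edge_irrefl.
Definition pendant (i : bool) : add_two_pendants := inr i.
End TwoPendants.

(* Rows and columns are indexed by the vertices through [enum_val]. *)
Definition adjmx (R : nzRingType) (Y : sgraph) : 'M[R]_#|Y| :=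
  \matrix_(i, j) (edge (enum_val i) (enum_val j))%:R.

Definition graph_mult (R : fieldType) (theta : R) (Y : sgraph) : nat :=
  mup theta (char_poly (adjmx R Y)).

(* Subspaces are row spaces, so matrices act on row vectors from the right.
   The rows of [kermx U^T] span the orthogonal complement of [U] for the
   standard inner product; over a real field it meets [U] trivially. *)
Definition orth_proj (R : realFieldType) n (U : 'M[R]_n) : 'M[R]_n :=
  proj_mx U (kermx U^T).

Definition basis_vec (R : nzRingType) (Y : sgraph) (w : Y) : 'rV[R]_#|Y| :=
  delta_mx 0 (enum_rank w).

Definition strongly_cospectral (R : realFieldType) (Y : sgraph) (b c : Y) :
    Prop :=
  forall theta : R, eigenvalue (adjmx R Y) theta ->
    let E := orth_proj (eigenspace (adjmx R Y) theta) in
    basis_vec R b *m E = basis_vec R c *m E \/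
    basis_vec R b *m E = - (basis_vec R c *m E).

(* Main.v *)
Require Import Defs.
From mathcomp Require Import all_boot all_order all_algebra.
From mathcomp Require Import reals.

Set Implicit Arguments.
Unset Strict Implicit.
Unset Printing Implicit Defensive.

Local Open Scope ring_scope.

Import Order.TTheory GRing.Theory Num.Theory.

(** Let [b], [c] be the two new vertices and let [U] be an eigenspace of [A(Z)]
    for [theta].  The projections of [e_b] and [e_c] onto [U] agree up to a
    sign as soon as [e_b - e_c] or [e_b + e_c] is orthogonal to [U]
    ([orth_proj_eq0]).

    For [u] in [U], the eigenvalue equation at [b] and at [c] reads
    [theta * u_b = u_a = theta * u_c], so [e_b - e_c] is orthogonal to [U]
    when [theta] is nonzero.  When [theta = 0] the claim is that
    [u_b + u_c = 0] ([pendant_sum_eq0]).  Here [u_a = 0], and the restriction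
    [y] of [u] to [X] satisfies [y A(X) = - (u_b + u_c) e_a].  If the scalar on
    the right were nonzero, then [e_a] would lie in the image of the symmetric
    matrix [A(X)], so that every vector of [ker A(X)] vanishes at [a].
    Together with [y], which is not in that kernel, [ker A(X)] would then span
    a space of vectors vanishing at [a] whose restrictions to [X \ a] are all
    in [ker A(X \ a)].  The nullity of [A(X \ a)] would thus exceed that of
    [A(X)] ([nullity_lt_principal]).

    The hypothesis speaks of multiplicities in characteristic polynomials.
    For a real symmetric matrix the multiplicity of [0] is the nullity
    ([mup0_char_poly_sym]), and this turns it into the opposite inequality
    between nullities. *)

(** * Orthogonality over a real field *)

Lemma mulmx_tr_eq0 (R : realFieldType) m n (M : 'M[R]_(m, n)) :
  M *m M^T = 0 -> M = 0.
Proof.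
move=> /matrixP MMt0; apply/matrixP => i j; rewrite mxE.
have := MMt0 i i; rewrite !mxE => /eqP; rewrite psumr_eq0; last first.
  by move=> k _; rewrite !mxE -expr2 sqr_ge0.
by move=> /allP/(_ j); rewrite mem_index_enum !mxE mulf_eq0 orbb => /(_ isT)/eqP.
Qed.

(** A vector of [U] orthogonal to [U] is orthogonal to itself. *)
Lemma capmx_kermx_tr (R : realFieldType) n (U : 'M[R]_n) :
  (U :&: kermx U^T)%MS = 0.
Proof.
set W := (U :&: _)%MS; apply: mulmx_tr_eq0.
have /submxP[D WE] : (W <= U)%MS by exact: capmxSl.
have /sub_kermxP WU0 : (W <= kermx U^T)%MS by exact: capmxSr.
by rewrite {2}WE trmx_mul mulmxA WU0 mul0mx.
Qed.

Lemma orth_proj_eq0 (R : realFieldType) m n (U : 'M[R]_n) (v : 'M[R]_(m, n)) :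
  v *m U^T = 0 -> v *m orth_proj U = 0.
Proof.
by move=> vU0; apply: proj_mx_0; [exact: capmx_kermx_tr | apply/sub_kermxP].
Qed.

(** * Algebraic and geometric multiplicity of the eigenvalue zero *)

(** Sylvester's identity: both sides compute, by eliminating one of the two
    off-diagonal blocks, the determinant of the matrix with blocks
    [X I], [L], [M] and [I], multiplied by [X^n]. *)
Lemma char_poly_mulmxC (R : comNzRingType) m n
    (L : 'M[R]_(m, n)) (M : 'M[R]_(n, m)) :
  'X^n * char_poly (L *m M) = 'X^m * char_poly (M *m L).
Proof.
pose Lp := map_mx polyC L; pose Mp := map_mx polyC M.
pose B := block_mx 'X%:M Lp Mp 1%:M : 'M[{poly R}]_(m + n).
have detB : \det B = char_poly (L *m M).
  have: block_mx 1%:M (- Lp) 0 1%:M *m B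
        = block_mx (char_poly_mx (L *m M)) 0 Mp 1%:M.
    rewrite mulmx_block !mul1mx !mul0mx !mulmx1 !mulNmx !add0r subrr.
    by rewrite /char_poly_mx map_mxM.
  by move/(congr1 determinant); rewrite det_mulmx det_ublock det_lblock !det1
    !mul1r mulr1.
have: block_mx 1%:M 0 (- Mp) 'X%:M *m B
      = block_mx 'X%:M Lp 0 (char_poly_mx (M *m L)).
  rewrite mulmx_block !mul1mx !mul0mx !mulmx1 !mulNmx !addr0.
  rewrite -scalar_mxC addNr addrC.
  by rewrite /char_poly_mx map_mxM.
move/(congr1 determinant); rewrite det_mulmx det_ublock det_lblock !det1.
by rewrite mul1r !det_scalar detB.
Qed.

(** Write [A = L M] as a rank factorization, with inner dimension [r].  By
    Sylvester's identity [char_poly A] is [X^(n - r)] times the characteristic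
    polynomial of the [r x r] matrix [M L], so it suffices that [M L] be
    invertible.  This is where symmetry enters: the row space of [A] meets its
    kernel trivially, hence [A A = L (M L) M] still has rank [r]. *)
Lemma mup0_char_poly_sym (R : realFieldType) n (A : 'M[R]_n) :
  A^T = A -> mup 0 (char_poly A) = \rank (kermx A).
Proof.
move=> symA; pose L := col_base A; pose M := row_base A.
have rankAA : \rank (A *m A) = \rank A.
  have := mxrank_mul_ker A A; have := capmx_kermx_tr A.
  by rewrite symA => ->; rewrite mxrank0 addn0.
have ML_unit : M *m L \in unitmx.
  rewrite -row_free_unit -row_leq_rank -{1}rankAA -{1 2}(mulmx_base A).
  rewrite -/L -/M mulmxA -(mulmxA L).
  exact: leq_trans (mxrankM_maxl _ _) (mxrankM_maxr _ _).
have NrootML : ~~ root (char_poly (M *m L)) 0.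
  rewrite rootE horner_coef0 char_poly_det mulf_eq0 signr_eq0 /=.
  by rewrite -unitfE -unitmxE.
have mupX k : mup 0 ('X^k : {poly R}) = k.
  by have := mup_XsubCX k (0 : R) 0; rewrite eqxx subr0.
have polyX0 k : 'X^k != 0 :> {poly R} by rewrite monic_neq0 ?monicXn.
have := congr1 (mup 0) (char_poly_mulmxC L M).
rewrite mulmx_base !mupM ?polyX0 ?monic_neq0 ?char_poly_monic // !mupX.
rewrite (mupNroot NrootML) addn0 mxrank_ker => mupE.
by rewrite -[X in (X - _)%N]mupE addKn.
Qed.

(** * Nullity of a symmetric matrix and of a principal submatrix *)

Section PrincipalSubmatrix.
Variables (F : fieldType) (m n : nat) (f : 'I_m -> 'I_n) (i0 : 'I_n).
Hypotheses (f_inj : injective f) (f_im : f @: setT = [set~ i0]).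

(** With [N] the identity matrix, this recovers [M] from its columns other
    than the null column [i0]: deleting that column loses no rank. *)
Lemma mul_colsub_rowsub p q (M : 'M[F]_(p, n)) (N : 'M[F]_(n, q)) :
  col i0 M = 0 -> colsub f M *m rowsub f N = M *m N.
Proof.
move=> /colP M0; apply/matrixP => k l; rewrite !mxE (bigD1 i0) //=.
have := M0 k; rewrite !mxE => ->; rewrite mul0r add0r.
transitivity (\sum_(i in f @: setT) M k i * N i l); last first.
  by apply: eq_bigl => i; rewrite f_im !inE.
rewrite big_imset /=; last by move=> j1 j2 _ _; exact: f_inj.
by apply: eq_big => [j|j _]; rewrite ?inE ?mxE.
Qed.

(** For [x] in the kernel, [s x_i0 = x (y A)^T = (x A) y^T = 0]; so the sum [N]
    of the kernel and the line of [y] has a null column [i0].  Deleting that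
    column maps [N] injectively into the kernel of the principal submatrix,
    because [N A] is supported on the deleted column; and [y] itself is not
    in the kernel of [A]. *)
Lemma nullity_lt_principal (A : 'M[F]_n) (y : 'rV[F]_n) (s : F) :
    A^T = A -> s != 0 -> y *m A = s *: 'e_i0 -> y 0 i0 = 0 ->
  (\rank (kermx A) < \rank (kermx (mxsub f f A)))%N.
Proof.
move=> symA s_neq0 yA yi0; pose N := (kermx A + y)%MS.
have e_neq0 : 'e_i0 != 0 :> 'rV[F]_n.
  by apply/eqP => /rowP/(_ i0)/eqP; rewrite !mxE !eqxx oner_eq0.
have N0 : col i0 N = 0.
  rewrite colE; apply/sub_kermxP; rewrite addsmx_sub; apply/andP; split.
    apply/sub_kermxP; apply: (scalerI s_neq0).
    rewrite scaler0 scalemxAr -[delta_mx _ _]trmx_delta -linearZ /= -yA.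
    by rewrite trmx_mul symA mulmxA mulmx_ker mul0mx.
  by apply/sub_kermxP; rewrite -colE; apply/colP => k; rewrite !mxE ord1.
have NA : N *m colsub f A = 0.
  apply/sub_kermxP; rewrite addsmx_sub; apply/andP; split; apply/sub_kermxP.
    by rewrite mulmx_colsub mulmx_ker; apply/matrixP => k l; rewrite !mxE.
  rewrite mulmx_colsub yA; apply/matrixP => k l; rewrite !mxE.
  have : f l \in f @: setT by rewrite imset_f.
  by rewrite f_im !inE => /negPf->; rewrite andbF mulr0.
have ltN : (\rank (kermx A) < \rank N)%N.
  apply: rank_ltmx; rewrite ltmxE addsmxSl addsmx_sub submx_refl /=.
  apply/negP => /sub_kermxP; rewrite yA => /eqP.
  by rewrite scaler_eq0 (negPf s_neq0) (negPf e_neq0).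
(* [N] is a multiple of [colsub f N], whose rank is therefore not smaller. *)
apply: leq_trans ltN _; rewrite -[N in \rank N]mulmx1 -(mul_colsub_rowsub _ N0).
apply: leq_trans (mxrankM_maxl _ _) _; apply/mxrankS/sub_kermxP.
have -> : mxsub f f A = rowsub f (colsub f A).
  by apply/matrixP => k l; rewrite !mxE.
by rewrite mul_colsub_rowsub.
Qed.

End PrincipalSubmatrix.

(** * Adjacency matrices *)

Lemma adjmx_tr (R : nzRingType) (Y : sgraph) : (adjmx R Y)^T = adjmx R Y.
Proof. by apply/matrixP => i j; rewrite !mxE edge_sym. Qed.

Lemma graph_mult0 (R : realFieldType) (Y : sgraph) :
  graph_mult (0 : R) Y = \rank (kermx (adjmx R Y)).
Proof. exact: mup0_char_poly_sym (adjmx_tr _ _). Qed.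

Lemma mul_adjmxE (R : nzRingType) (Y : sgraph) (u : 'rV[R]_#|Y|) (z : Y) :
  (u *m adjmx R Y) 0 (enum_rank z)
  = \sum_(x : Y) u 0 (enum_rank x) * (edge x z)%:R.
Proof.
rewrite mxE (reindex _ (onW_bij _ (@enum_rank_bij Y))) /=.
by apply: eq_bigr => x _; rewrite !mxE !enum_rankK.
Qed.

Section Pendants.
Variables (R : realFieldType) (X : sgraph) (a : X).
Let Z := add_two_pendants a.

Lemma mul_adjmx_pendant (u : 'rV[R]_#|Z|) (i : bool) :
  (u *m adjmx R Z) 0 (enum_rank (pendant a i))
  = u 0 (enum_rank (inl a : Z)).
Proof.
rewrite mul_adjmxE big_sumType /= [X in _ + X]big1 ?addr0; last first.
  by move=> j _; rewrite mulr0.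
rewrite (bigD1 a) //= eqxx mulr1 big1 ?addr0 // => x /negPf xa.
by rewrite xa mulr0.
Qed.

Lemma mul_adjmx_old (u : 'rV[R]_#|Z|) (x : X) :
  (u *m adjmx R Z) 0 (enum_rank (inl x : Z))
  = ((\row_j u 0 (enum_rank (inl (enum_val j) : Z))) *m adjmx R X)
      0 (enum_rank x)
    + (u 0 (enum_rank (pendant a false)) + u 0 (enum_rank (pendant a true)))
      * (x == a)%:R.
Proof.
rewrite !mul_adjmxE big_sumType /= big_bool /= mulrDl.
rewrite [X in _ + X]addrC; congr (_ + _).
by apply: eq_bigr => w _; rewrite mxE enum_rankK.
Qed.

Definition del_index (j : 'I_#|del_vertex a|) : 'I_#|X| :=
  enum_rank (val (enum_val j)).

Lemma del_index_inj : injective del_index.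
Proof. by move=> i j /enum_rank_inj/val_inj/enum_val_inj. Qed.

Lemma del_index_im : del_index @: setT = [set~ enum_rank a].
Proof.
apply/setP => i; rewrite !inE; apply/imsetP/idP => [[j _ ->]|ia].
  by rewrite (inj_eq enum_rank_inj) (valP (enum_val j)).
have iaP : enum_val i != a by apply: contraNneq ia => <-; rewrite enum_valK.
exists (enum_rank (Sub (enum_val i) iaP : del_vertex a)) => //.
by rewrite /del_index enum_rankK /= enum_valK.
Qed.

Lemma adjmx_del_vertex :
  adjmx R (del_vertex a) = mxsub del_index del_index (adjmx R X).
Proof. by apply/matrixP => i j; rewrite !mxE !enum_rankK. Qed.

(** The restriction of [u] to [X] is the witness that the nullity of
    [X \ a] would exceed that of [X] if the sum were nonzero: it vanishes at
    [a], and [A(X)] sends it to a multiple of [e_a], since only at [a] does the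
    equation [u A(Z) = 0] involve the pendant coordinates. *)
Lemma pendant_sum_eq0 (u : 'rV[R]_#|Z|) :
    (graph_mult (0 : R) (del_vertex a) <= graph_mult (0 : R) X)%N ->
    u *m adjmx R Z = 0 ->
  u 0 (enum_rank (pendant a false)) + u 0 (enum_rank (pendant a true)) = 0.
Proof.
rewrite !graph_mult0 adjmx_del_vertex leqNgt => /negP nlt uA0.
apply/eqP/negPn/negP => s_neq0; apply: nlt; rewrite -oppr_eq0 in s_neq0.
pose y : 'rV[R]_#|X| := \row_j u 0 (enum_rank (inl (enum_val j) : Z)).
apply: (nullity_lt_principal (@del_index_inj) del_index_im (y := y)
  (adjmx_tr _ _) s_neq0).
  apply/rowP => j; rewrite -(enum_valK j).
  have := mul_adjmx_old u (enum_val j); rewrite uA0 mxE => /esym/eqP.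
  rewrite addr_eq0 => /eqP->.
  by rewrite !mxE eqxx (inj_eq enum_rank_inj) mulNr.
by rewrite mxE enum_rankK -(mul_adjmx_pendant u false) uA0 mxE.
Qed.

Lemma basis_vec_pendant_adjmx (i : bool) :
  basis_vec R (pendant a i) *m adjmx R Z = basis_vec R (inl a : Z).
Proof.
apply/rowP => j; rewrite /basis_vec -rowE !mxE enum_rankK eqxx /=.
by rewrite -[j in RHS]enum_valK (inj_eq enum_rank_inj); case: (enum_val j).
Qed.

End Pendants.

Theorem lemma9p3 (R : realType) (X : sgraph) (a : X)
    (hmult : (graph_mult (0%R : R) (del_vertex a) <= graph_mult (0%R : R) X)%N) :
  strongly_cospectral R (pendant a false) (pendant a true).
Proof.
move=> theta _ /=; set A := adjmx R _; set U := eigenspace A theta.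
have UA : U *m A = theta *: U by apply/eigenspaceP; exact: submx_refl.
have [theta0|theta_neq0] := eqVneq theta 0; [right|left]; apply/eqP.
- rewrite -addr_eq0 -mulmxDl orth_proj_eq0 //.
  apply/rowP => i; rewrite mulmxDl /basis_vec -!rowE !mxE.
  have uA : row i U *m A = 0 by rewrite -row_mul UA theta0 scale0r row0.
  by have := pendant_sum_eq0 hmult uA; rewrite !mxE.
- rewrite -subr_eq0 -mulmxBl orth_proj_eq0 //.
  (* [theta v U^T = v (U A)^T = (v A) U^T], and [v = e_b - e_c] is sent to
     [e_a - e_a] by [A]. *)
  apply: (scalerI theta_neq0); rewrite scaler0 scalemxAr -linearZ /= -UA.
  rewrite trmx_mul adjmx_tr mulmxA mulmxBl !basis_vec_pendant_adjmx.
  by rewrite subrr mul0mx.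
Qed.
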